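(* Let $\mu:\mathcal{P}(\mathcal{C})\to L^*$ be a capacity and $f:\mathcal{C}\to L^*$ an input vector. Then $\int_{\mathrm{DPR},\mu}^{\to_D} f=*$ if and only if there exists $i\in\mathcal{C}$ with $f_i\in\{0,*\}$ and at least one of the following conditions is satisfied: (a) $\mu^c(\{i\in\mathcal{C}\mid f_i=0\})=*$; (b) $f_i=0$ for at least one $i\in\mathcal{C}$, $\mu^c(\{i\in\mathcal{C}\mid f_i=0\})=0$, and $\mu^c(\{j\in\mathcal{C}\mid f_j\le_\ell *\})=1$; (c) $f_i>_\ell 0$ for all $i\in\mathcal{C}$, and $\mu^c(\{i\in\mathcal{C}\mid f_i=*\})=1$.
   Context: Residuated lattice: $L=(L,\wedge,\vee,\otimes,\to,0,1)$ is a linearly ordered residuated lattice: $(L,\wedge,\vee,0,1)$ is a linearly ordered lattice with bottom $0$ and top $1$ ($0\neq 1$), $(L,\otimes,1)$ is a commutative monoid, and $\alpha\otimes\beta\le\gamma$ iff $\alpha\le\beta\to\gamma$. The underlying ordered set of $L$ is either a closed real interval $[a,b]$ with $a<b$ or a finite subset of $[a,b]$ containing $a$ and $b$ (with $0,1$ denoting the bottom and top elements). Standing assumption: $L$ has no zero divisors with respect to $\otimes$, i.e. $\alpha\otimes\beta=0$ implies $\alpha=0$ or $\beta=0$. Dragonfly algebra: $L^*=L\cup\{*\}$ with $*\notin L$ (the ''unknown value''). Its linear order $\le_\ell$ extends the order of $L$ by $0<_\ell *<_\ell\alpha$ for all $\alpha\in L\setminus\{0\}$; $\wedge_D,\vee_D$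 are the minimum and maximum with respect to $\le_\ell$, and $\bigwedge_D,\bigvee_D$ denote infimum and supremum with respect to $\le_\ell$ (with $\bigwedge_D\emptyset=1$, $\bigvee_D\emptyset=0$). The residuum $\to_D$ on $L^*$ is: $\alpha\to_D\beta=\alpha\to\beta$ for $\alpha,\beta\in L$; $\alpha\to_D *=*$ for $\alpha\in L\setminus\{0\}$; $0\to_D *=1$; $*\to_D *=1$; $*\to_D 0=*$; $*\to_D\beta=\beta$ for $\beta\in L\setminus\{0\}$. $\mathcal{C}=\{1,\dots,n\}$ is a finite non-empty set with power set $\mathcal{P}(\mathcal{C})$. An input vector is a map $f:\mathcal{C}\to L^*$, $f_i=f(i)$. A capacity is a map $\mu:\mathcal{P}(\mathcal{C})\to L^*$ with $\mu(\emptyset)=0$, $\mu(\mathcal{C})=1$, and $A\subseteq B\Rightarrow\mu(A)\le_\ell\mu(B)$. Put $\mu^c(A)=\mu(\mathcal{C}\setminus A)\to_D 0$. The residuum-based qualitative integral is $$\int_{\mathrm{DPR},\mu}^{\to_D} f=\bigwedge_{D,\,A\subseteq\mathcal{C}}\Big(\mu^c(A)\to_D\bigvee_{D,\,i\in A}f_i\Big).$$ *)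

(* Defs.v *)
From HB Require Import structures.
From mathcomp Require Import all_boot all_order all_algebra.
From mathcomp Require Import reals.

Set Implicit Arguments.
Unset Strict Implicit.
Unset Printing Implicit Defensive.

Import Order.TTheory.

Local Open Scope order_scope.

Record real_chain (R : realType) := RealChain {
  lo : R;
  hi : R;
  points : {pred R};
  lo_lt_hi : lo < hi;
  pointsP :
    points =i `[lo, hi]
    \/ exists s : seq R,
         [/\ points =i s, {subset s <= `[lo, hi]}, lo \in s & hi \in s] }.

Record point (R : realType) (K : real_chain R) :=
  Point { point_val : R; point_valP : point_val \in points K }.

Coercion point : real_chain >-> Sortclass.

Section ChainOrder.
Context {R : realType} (K : real_chain R).

HB.instance Definition _ := [isSub of point K for @point_val R K].
HB.instance Definition _ := [Choice of point K by <:].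
HB.instance Definition _ := [SubChoice_isSubOrder of point K by <: with ring_display].

Fact lo_points : lo K \in points K.
Proof.
by case: (pointsP K) => [->|[s [-> _ ? _]]] //;
  rewrite in_itv /= lexx ltW ?lo_lt_hi.
Qed.

Fact hi_points : hi K \in points K.
Proof.
by case: (pointsP K) => [->|[s [-> _ _ ?]]] //;
  rewrite in_itv /= lexx ltW ?lo_lt_hi.
Qed.

Fact point_itv (x : K) : lo K <= val x <= hi K.
Proof.
have := valP x; case: (pointsP K) => [->|[s [-> sub _ _]] /sub];
  by rewrite in_itv.
Qed.

Fact point_ge_lo (x : K) : Point lo_points <= x.
Proof. by case/andP: (point_itv x). Qed.

Fact point_le_hi (x : K) : x <= Point hi_points.
Proof. by case/andP: (point_itv x). Qed.

HB.instance Definition _ := Order.hasBottom.Build _ (point K) point_ge_lo.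
HB.instance Definition _ := Order.hasTop.Build _ (point K) point_le_hi.

Fact point_bot_lt_top : (\bot : K) < \top.
Proof. exact: lo_lt_hi. Qed.

End ChainOrder.

(* The lattice operations, 0 = \bot and 1 = \top are those of the chain. *)
Record residuated_lattice (R : realType) := ResiduatedLattice {
  chain :> real_chain R;
  tens : chain -> chain -> chain;
  resid : chain -> chain -> chain;
  tensA : associative tens;
  tensC : commutative tens;
  tens1x : left_id \top tens;
  tens_residP : forall x y z : chain, (tens x y <= z) = (x <= resid y z) }.

Definition no_zero_divisors (R : realType) (L : residuated_lattice R) :=
  forall x y : L, tens x y = \bot -> x = \bot \/ y = \bot.

Variant dragonfly (R : realType) (K : real_chain R) := Known of K | Unknown.
Arguments Known {R K}.
Arguments Unknown {R K}.

Section DragonflyOrder.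
Context {R : realType} (K : real_chain R).
Implicit Types x y z : dragonfly K.

Definition dragonfly_opt x : option K := if x is Known u then Some u else None.
Definition opt_dragonfly (o : option K) : dragonfly K :=
  if o is Some u then Known u else Unknown.
Fact dragonfly_optK : cancel dragonfly_opt opt_dragonfly.
Proof. by case. Qed.

HB.instance Definition _ :=
  Choice.copy (dragonfly K) (can_type dragonfly_optK).

Definition dragonfly_le x y :=
  match x, y with
  | Known u, Known v => u <= v
  | Known u, Unknown => u == \bot
  | Unknown, Known v => v != \bot
  | Unknown, Unknown => true
  end.

Fact dragonfly_display : Order.disp_t. Proof. exact: Order.Disp tt tt. Qed.

Fact dragonfly_le_refl : reflexive dragonfly_le.
Proof. by case=> [u|] //=. Qed.

Fact dragonfly_le_anti : antisymmetric dragonfly_le.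
Proof.
case=> [u|] [v|] //=.
- by move=> /le_anti ->.
- by rewrite andbN.
- by rewrite andNb.
Qed.

Fact dragonfly_le_trans : transitive dragonfly_le.
Proof.
case=> [v|] [u|] [w|] //=.
- exact: le_trans.
- by move=> uv /eqP v0; rewrite v0 lex0 in uv.
- by rewrite -!lt0x; apply: lt_le_trans.
- by move=> /eqP -> _; apply: le0x.
Qed.

Fact dragonfly_le_total : total dragonfly_le.
Proof.
case=> [u|] [v|] //=; [exact: le_total | exact: orbN | exact: orNb].
Qed.

HB.instance Definition _ :=
  Order.Le_isPOrder.Build dragonfly_display (dragonfly K)
    dragonfly_le_refl dragonfly_le_anti dragonfly_le_trans.
HB.instance Definition _ :=
  Order.POrder_isTotal.Build dragonfly_display (dragonfly K) dragonfly_le_total.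

Fact dragonfly_ge_bot x : Known \bot <= x.
Proof. by case: x => [u|]; [exact: le0x | exact: eqxx]. Qed.

Fact dragonfly_le_top x : x <= Known \top.
Proof.
by case: x => [u|]; [exact: lex1 | rewrite /Order.le /= -lt0x point_bot_lt_top].
Qed.

HB.instance Definition _ :=
  Order.hasBottom.Build dragonfly_display (dragonfly K) dragonfly_ge_bot.
HB.instance Definition _ :=
  Order.hasTop.Build dragonfly_display (dragonfly K) dragonfly_le_top.

End DragonflyOrder.

Section Integral.
Context {R : realType} {L : residuated_lattice R}.

Definition residD (x y : dragonfly L) : dragonfly L :=
  match x, y with
  | Known u, Known v => Known (resid u v)
  | Known u, Unknown => if u == \bot then \top else Unknown
  | Unknown, Unknown => \top
  | Unknown, Known v => if v == \bot then Unknown else Known v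
  end.

Context {n : nat}.
Implicit Types (mu : {set 'I_n} -> dragonfly L) (f : 'I_n -> dragonfly L).

Definition capacity mu :=
  [/\ mu set0 = \bot, mu setT = \top
    & forall A B : {set 'I_n}, A \subset B -> mu A <= mu B].

Definition conj_capacity mu (A : {set 'I_n}) : dragonfly L :=
  residD (mu (~: A)) \bot.

(* \meet and \join are inf and sup for the order of L*: over an empty range
   they are \top and \bot. *)
Definition integralDPR mu f : dragonfly L :=
  \meet_(A : {set 'I_n}) residD (conj_capacity mu A) (\join_(i in A) f i).

End Integral.

(* Main.v *)
Require Import Defs.
From mathcomp Require Import all_boot all_order all_algebra.
From mathcomp Require Import reals.

(** Without zero divisors the negation [x ->_D 0] takes only the values 0, *
    and 1, so the conjugate capacity does too; it is moreover monotone and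
    vanishes on the empty set.  For such a value [c], the term [c ->_D y] is 0
    only for [c = 1, y = 0], and it is * only for [c = 1, y = *] or
    [c = *, y = 0].

    Let [Z] be the set where [f] is 0 and [S] the set where [f] is at most *.
    The integral is a finite infimum in a chain, so it equals * exactly when no
    term is 0 and some term is *.  The supremum of [f] over [A] is 0 iff [A] is
    included in [Z], and at most * iff [A] is included in [S].  Hence, by
    monotonicity, some term is 0 iff the conjugate capacity of [Z] is 1; and when
    it is not 1, some term is * iff either the conjugate capacity of [Z] is * or
    that of [S] is 1 (the sets [Z] and [S] themselves provide the extremal
    terms).  This is [integralDPR_Unknown].

    The three conditions of the theorem are this criterion split according to
    whether the conjugate capacity of [Z] is * or 0 and, in the latter case,
    whether [Z] is empty; when [Z] is empty, [S] is the set where [f] is *. *)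

Set Implicit Arguments.
Unset Strict Implicit.
Unset Printing Implicit Defensive.

Import Order.TTheory.

Local Open Scope order_scope.

Section FiniteMeet.
Context {disp : Order.disp_t} {T : tbOrderType disp} {I : finType}.

(** A finite infimum in a chain is attained, unless it is the infimum of the
    empty family; this is why the top is excluded. *)
Lemma meets_eqP (F : I -> T) (x : T) : x <> \top ->
  \meet_i F i = x <-> (forall i, x <= F i) /\ exists i, F i = x.
Proof.
move=> xN1; split=> [Fx|[xF [i Fi]]]; last first.
  by apply/le_anti/andP; split; [rewrite -Fi; exact: meets_inf | exact/meetsP].
split=> [i|]; first by rewrite -Fx; exact: meets_inf.
have [|//] : \meet_i F i = \top \/ exists i, F i = \meet_i F i; last first.
- by case=> i Fi; exists i; rewrite Fi.
- by rewrite Fx.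
apply: (big_ind (fun y => y = \top \/ exists i, F i = y)) => [|y z Py Pz|i _].
- by left.
- by case: (leP y z).
- by right; exists i.
Qed.

End FiniteMeet.

Section Residuum.
Context {R : realType} {L : residuated_lattice R}.
Implicit Types (u v : L) (x y : dragonfly L).

Lemma tens0x u : tens \bot u = \bot.
Proof. by apply/eqP; rewrite -lex0 tens_residP le0x. Qed.

Lemma resid0x v : resid \bot v = \top :> L.
Proof. by apply/eqP; rewrite -le1x -tens_residP tensC tens0x le0x. Qed.

Lemma resid1x v : resid \top v = v :> L.
Proof.
have le_resid (w : L) : (w <= resid \top v) = (w <= v).
  by rewrite -tens_residP tensC tens1x.
by apply/le_anti; rewrite -le_resid lexx le_resid lexx.
Qed.

Lemma bot_neq_top : (\bot : L) <> \top.
Proof. by move=> e; have := point_bot_lt_top L; rewrite e ltxx. Qed.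

Lemma residD0x y : residD \bot y = \top.
Proof. by case: y => [v|] /=; rewrite ?resid0x ?eqxx. Qed.

Lemma residD1x y : residD \top y = y.
Proof.
case: y => [v|] /=; first by rewrite resid1x.
by case: eqP => // e; case: (bot_neq_top (esym e)).
Qed.

Lemma bot_neq_topD : (\bot : dragonfly L) <> \top.
Proof. by case=> e; have := lo_lt_hi L; rewrite e ltxx. Qed.

Lemma lt0D x : (\bot < x) = (Unknown <= x).
Proof. by rewrite lt0x; case: x. Qed.

Variant negD_spec x : dragonfly L -> Prop :=
  | NegDBot of x = \bot : negD_spec x \top
  | NegDUnknown of x = Unknown : negD_spec x Unknown
  | NegDPos of Unknown < x : negD_spec x \bot.

(** For a nonzero [u] of [L], the element [u -> 0] annihilates [u], so it is 0
    for lack of zero divisors. *)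
Lemma negDP : no_zero_divisors L -> forall x, negD_spec x (residD x \bot).
Proof.
move=> nzd [u|] /=; last by rewrite eqxx; constructor.
have [->|uN0] := eqVneq u \bot; first by rewrite resid0x; constructor.
have -> : resid u \bot = \bot :> L.
  have : tens (resid u \bot) u = \bot.
    by apply/eqP; rewrite -lex0 tens_residP.
  by case/nzd => // u0; rewrite u0 eqxx in uN0.
by constructor; rewrite lt_neqAle.
Qed.

End Residuum.

Section Criterion.
Context {R : realType} {L : residuated_lattice R} (nzd : no_zero_divisors L).
Context {n : nat} {mu : {set 'I_n} -> dragonfly L} (mu_cap : capacity mu).
Implicit Types (A B : {set 'I_n}) (f : 'I_n -> dragonfly L).

Local Notation muc := (conj_capacity mu).

Lemma conj_capacity_cases A :
  [\/ muc A = \bot, muc A = Unknown | muc A = \top].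
Proof.
rewrite /conj_capacity; case: negDP => // _.
- exact: Or33.
- exact: Or32.
- exact: Or31.
Qed.

Lemma conj_capacity0 : muc set0 = \bot.
Proof.
by case: mu_cap => _ muT _; rewrite /conj_capacity setC0 muT residD1x.
Qed.

(** Complementation and negation are both antitone. *)
Lemma conj_capacity_mono A B : A \subset B -> muc A <= muc B.
Proof.
case: mu_cap => _ _ mu_mono sAB.
have := mu_mono (~: B) (~: A); rewrite setCS sAB => /(_ isT).
rewrite /conj_capacity.
case: (negDP nzd (mu (~: A))) => [->|->|_]; last by rewrite le0x.
  by rewrite lex0 => /eqP ->; rewrite residD0x.
case: (negDP nzd (mu (~: B))) => [_ _|_ _|]; rewrite ?lex1 ?lexx //.
by move=> /lt_geF ->.
Qed.

Lemma joins_eq0 f A :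
  (\join_(i in A) f i == \bot) = (A \subset [set i | f i == \bot]).
Proof.
rewrite -lex0; apply/joinsP/subsetP => h i iA; have := h i iA;
  by rewrite inE lex0.
Qed.

Lemma joins_leU f A :
  (\join_(i in A) f i <= Unknown) = (A \subset [set i | f i <= Unknown]).
Proof. by apply/joinsP/subsetP => h i iA; have := h i iA; rewrite inE. Qed.

(** The terms need not be monotone in [A]: raising the supremum from 0 to * turns
    [* ->_D 0 = *] into [* ->_D * = 1].  So the terms equal to * are located by
    cases on the value of the conjugate capacity, not by comparing terms. *)
Lemma integralDPR_Unknown f :
  let Z := [set i | f i == \bot] in
  let S := [set i | f i <= Unknown] in
  integralDPR mu f = Unknown <->
  muc Z <> \top /\ (muc Z = Unknown \/ muc S = \top).
Proof.
move=> Z S; have UN1 : Unknown <> \top :> dragonfly L by [].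
have joinZ : \join_(i in Z) f i = \bot by apply/eqP; rewrite joins_eq0.
rewrite /integralDPR (meets_eqP _ UN1); split=> [[noZero [A TA]]|[ZN1 ZS]].
  have ZN1 : muc Z <> \top.
    by move=> Z1; have := noZero Z; rewrite Z1 residD1x joinZ -lt0D ltxx.
  split=> //; case: (conj_capacity_cases A) => cA; move: TA; rewrite cA.
  - by rewrite residD0x.
  - (* A term whose premise is * equals * only if its supremum is 0. *)
    case jA: (\join_(i in A) f i) => [v|] //=; case: eqP => // v0 _; left.
    have sAZ : A \subset Z by rewrite -joins_eq0 jA v0.
    have := conj_capacity_mono sAZ; rewrite cA -lt0D.
    by case: (conj_capacity_cases Z) => // ->; rewrite ltxx.
  - rewrite residD1x => jA; right; apply/eqP; rewrite -le1x -cA.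
    by apply: conj_capacity_mono; rewrite -joins_leU jA.
split=> [A|].
  case: (conj_capacity_cases A) => cA; rewrite cA.
  - by rewrite residD0x lex1.
  - by case: (\join_(i in A) f i) => [v|] //=; case: ifP => [_|/negbT].
  - rewrite residD1x -lt0D lt0x joins_eq0; apply/negP => sAZ; apply: ZN1.
    by apply/eqP; rewrite -le1x -cA conj_capacity_mono.
case: ZS => [ZU|S1]; [exists Z | exists S].
  by rewrite ZU joinZ /= eqxx.
rewrite S1 residD1x; apply/le_anti; rewrite joins_leU subxx /= -lt0D lt0x.
rewrite joins_eq0; apply/negP => sSZ; apply: ZN1.
by apply/eqP; rewrite -le1x -S1 conj_capacity_mono.
Qed.

End Criterion.

Theorem theorem8 (R : realType) (L : residuated_lattice R)
    (L_nzd : no_zero_divisors L) (n : nat) (n_gt0 : (0 < n)%N)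
    (mu : {set 'I_n} -> dragonfly L) (mu_cap : capacity mu)
    (f : 'I_n -> dragonfly L) :
  integralDPR mu f = Unknown <->
  (exists i : 'I_n, f i = \bot \/ f i = Unknown) /\
  [\/ conj_capacity mu [set i | f i == \bot] = Unknown,
      [/\ exists i : 'I_n, f i = \bot,
          conj_capacity mu [set i | f i == \bot] = \bot
        & conj_capacity mu [set j | f j <= Unknown] = \top]
    | (forall i : 'I_n, \bot < f i) /\
      conj_capacity mu [set i | f i == Unknown] = \top].
Proof.
rewrite (integralDPR_Unknown L_nzd mu_cap).
set muc := conj_capacity mu; set Z := [set i | f i == \bot].
have muc0 : muc set0 = \bot by exact: conj_capacity0.
have Z0 : (forall i, \bot < f i) -> Z = set0.
  by move=> f_gt0; apply/setP => i; rewrite !inE gt_eqF.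
have SU : (forall i, \bot < f i) ->
    [set i | f i <= Unknown] = [set i | f i == Unknown].
  by move=> f_gt0; apply/setP => i; rewrite !inE eq_le -lt0D f_gt0 andbT.
(* The empty set has conjugate capacity 0, which is neither * nor 1. *)
have nonempty A : muc A <> \bot -> exists i, i \in A.
  by move=> AN0; apply/set0Pn/eqP => A0; apply: AN0; rewrite A0.
split=> [[ZN1 ZS]|[_ abc]].
  have [zero|f_gt0] : (exists i, f i = \bot) \/ (forall i, \bot < f i).
  - have [Ze|/set0Pn[i]] := eqVneq Z set0; last first.
      by rewrite inE => /eqP fi; left; exists i.
    by right=> i; have := in_set0 i; rewrite -Ze inE lt0x => ->.
  - split; first by case: zero => i fi; exists i; left.
    case: (@conj_capacity_cases _ _ L_nzd _ mu Z) => // [cZ|cZ]; last by apply: Or31.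
    by case: ZS => [|cS]; [rewrite /muc cZ | apply: Or32].
  have cU : muc [set i | f i == Unknown] = \top.
    by case: ZS; [rewrite Z0 // muc0 | rewrite SU].
  split; last by apply: Or33.
  have [|i] := nonempty [set i | f i == Unknown].
    by rewrite cU => /esym/bot_neq_topD.
  by rewrite inE => /eqP fi; exists i; right.
case: abc => [ZU|[_ cZ cS]|[f_gt0 cU]].
- by rewrite ZU; split=> //; left.
- by rewrite cZ cS; split; [exact: bot_neq_topD | right].
- by rewrite Z0 // SU // muc0 cU; split; [exact: bot_neq_topD | right].
Qed.
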